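(* Let $F:\mathbb R^n\to\mathbb R^n$ be a local diffeomorphism, $n\ge 3$. If for every affine $2$-plane $P\subset\mathbb R^n$ the pre-image $F^{-1}(P)$, with the Riemannian metric induced from the Euclidean metric of $\mathbb R^n$, is a surface conformally diffeomorphic to $\mathbb R^2$, then $F$ is injective.
   Context: ''Local diffeomorphism'' means a smooth map whose differential is invertible at every point. The surface $F^{-1}(P)$ carries the metric obtained by restricting the standard inner product of $\mathbb R^n$. A conformal diffeomorphism between Riemannian surfaces is a diffeomorphism that pulls the metric of the target back to a positive smooth function times the metric of the source. *)

(* Defs.v *)
From HB Require Import structures.
From mathcomp Require Import all_boot all_order all_algebra.
From mathcomp Require Import all_classical all_reals all_analysis.

Set Implicit Arguments.
Unset Strict Implicit.
Unset Printing Implicit Defensive.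
Import Order.TTheory GRing.Theory Num.Theory.
Import numFieldNormedType.Exports.
Local Open Scope classical_set_scope.
Local Open Scope ring_scope.

(* [f] is of class C^k on the open set [U]: f is C^(k+1) iff it is
   differentiable and x |-> df_x is C^k.  The condition on df is tested on
   each fixed vector v, which is equivalent since only finite-dimensional
   spaces V are used below. *)
Fixpoint Ck (R : realType) (V W : normedModType R) (k : nat) (U : set V)
    (f : V -> W) : Prop :=
  if k is k'.+1 then
    (forall x, U x -> differentiable f x) /\
    (forall v : V, Ck k' U (fun x => 'd f x v))
  else forall x, U x -> {for x, continuous f}.

Definition Cinfty (R : realType) (V W : normedModType R) (U : set V)
    (f : V -> W) : Prop :=
  forall k, Ck k U f.

Definition local_diffeomorphism (R : realType) (n : nat)
    (F : 'rV[R]_n -> 'rV[R]_n) : Prop :=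
  Cinfty [set: 'rV[R]_n] F /\
  forall x, bijective ('d F x : 'rV[R]_n -> 'rV[R]_n).

Definition dot (R : realType) (n : nat) (u v : 'rV[R]_n) : R :=
  \sum_(i < n) u 0 i * v 0 i.

Definition affine_plane (R : realType) (n : nat) (P : set 'rV[R]_n) : Prop :=
  exists (p : 'rV[R]_n) (W : 'M[R]_(2, n)),
    row_free W /\ P = [set p + t *m W | t in [set: 'rV[R]_2]].

(* Maps between (sub)sets of Euclidean spaces are represented by total
   functions, whose values outside the domain [S] are irrelevant: smoothness on
   S is the local existence of smooth extensions to the ambient space, which on
   an embedded submanifold is smoothness in charts. *)
Definition smooth_on (R : realType) (V W : normedModType R) (S : set V)
    (f : V -> W) : Prop :=
  forall p, S p -> exists (U : set V) (g : V -> W),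
    [/\ open U, U p, Cinfty U g & forall x, U x -> S x -> g x = f x].

(* Only meant for embedded submanifolds S and T.  If T is an open subset of
   R^d, the existence of f forces S to be an embedded d-submanifold. *)
Definition diffeomorphism (R : realType) (n m : nat)
    (S : set 'rV[R]_n) (T : set 'rV[R]_m) (f : 'rV[R]_n -> 'rV[R]_m) : Prop :=
  smooth_on S f /\
  exists g : 'rV[R]_m -> 'rV[R]_n,
    [/\ smooth_on T g,
        (forall x, S x -> T (f x)), (forall y, T y -> S (g y)),
        (forall x, S x -> g (f x) = x) & (forall y, T y -> f (g y) = y)].

Definition curve_through (R : realType) (n : nat) (S : set 'rV[R]_n)
    (p : 'rV[R]_n) (c : R -> 'rV[R]_n) : Prop :=
  [/\ Cinfty [set: R] c, (forall t, S (c t)) & c 0 = p].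

(* The tangent vectors to S at p are the velocities c'(0) of the smooth curves
   c in S through p, and the differential of f at p maps c'(0) to (f o c)'(0).
   The metrics of S and T are the restrictions of [dot], so the last clause
   says that f pulls the metric of T back to lambda times the metric of S. *)
Definition conformal_diffeomorphism (R : realType) (n m : nat)
    (S : set 'rV[R]_n) (T : set 'rV[R]_m) (f : 'rV[R]_n -> 'rV[R]_m) : Prop :=
  diffeomorphism S T f /\
  exists lambda : 'rV[R]_n -> R,
    [/\ smooth_on S lambda,
        (forall p, S p -> 0 < lambda p) &
        forall p c1 c2, curve_through S p c1 -> curve_through S p c2 ->
          dot (derive1 (f \o c1) 0) (derive1 (f \o c2) 0) =
            lambda p * dot (derive1 c1 0) (derive1 c2 0)].

(* Main.v *)
Require Import Defs.
From HB Require Import structures.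
From mathcomp Require Import all_boot all_order all_algebra.
From mathcomp Require Import ring lra.
From mathcomp Require Import all_classical all_reals all_analysis.

Set Implicit Arguments.
Unset Strict Implicit.
Unset Printing Implicit Defensive.
Import Order.TTheory GRing.Theory Num.Theory.
Import numFieldNormedType.Exports.
Local Open Scope classical_set_scope.
Local Open Scope ring_scope.

(** Only the fact that the preimage of every plane is homeomorphic to R^2 is
    used.  Suppose F a = F b = q, and let P_t be the pencil of planes through a
    line l containing q, with P_t spanned by l and a transverse vector nu_t that
    turns from nu_(-1) to nu_1 = - nu_(-1).  The leaf L of F^-1(l) through a is
    open and closed in F^-1(l), and F is injective on it, so b is not on L if
    a <> b.  The surface S_t = F^-1(P_t) is simply connected, so it carries a
    Z/2-valued function s_t that is locally constant off L and jumps across L;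
    normalised near a by the sign of the nu_t-coordinate, it tells on which side
    of L the point b lies.  As L does not depend on t, s_t(b) is locally constant
    in t; but S_1 = S_(-1) with opposite orientations of nu, so s_1(b) and
    s_(-1)(b) differ. *)

(** * Cocycles on the line and the plane *)

(** The level set of [f x] is open and closed relative to [A]. Since [Y] carries no topology, [f]
    may take values in [Prop], so that a property which propagates locally spreads over all of
    [A]. *)
Lemma connected_locally_constant (Z : topologicalType) (Y : Type) (A : set Z)
    (f : Z -> Y) : connected A ->
  (forall x, A x -> \forall y \near x, A y -> f y = f x) ->
  forall x y, A x -> A y -> f x = f y.
Proof.
move=> cA lc x y Ax Ay.
suff AE : A `&` [set z | f z = f x] = A.
  by move: Ay; rewrite -AE => -[_ /=].
apply: cA; first by exists x.
- exists (interior [set z | A z -> f z = f x]); first exact: open_interior.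
  apply/seteqP; split => z [Az /= fz]; split => //.
    by apply: filterS (lc _ Az) => w wf Aw; rewrite wf.
  by have /nbhs_singleton := fz; exact.
- exists (~` interior [set z | A z -> f z <> f x]).
    exact/open_closedC/open_interior.
  apply/seteqP; split => z [Az /= fz]; split => //.
    by move/nbhs_singleton => /(_ Az).
  apply: contrapT => nfz; apply: fz.
  by apply: filterS (lc _ Az) => w wf Aw; rewrite wf.
Qed.

(** * Unique continuation along the real line *)

Section continuation.
Context {R : realType} {Y : Type} (Sol : (R -> Y) -> R -> Prop).
Hypothesis Sol_germ : forall f g x,
  (\forall y \near x, f y = g y) -> Sol f x -> Sol g x.
Hypothesis Sol_eq : forall f g x, (\forall y \near x, Sol f y /\ Sol g y) ->
  \forall y \near x, f y = g y <-> f x = g x.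

(** [Sol f x] stands for a local condition on the germ of [f] at [x]; it will be instantiated with
    primitives of a cocycle and with lifts of a line. The interval [J] may depend on [r], which
    avoids constructing a maximal solution. *)
Definition reach (y0 : Y) (r : R) (v : Y) := exists (J : set R) (f : R -> Y),
  [/\ open J, connected J, J 0 & J r] /\
  [/\ forall u, J u -> Sol f u, f 0 = y0 & f r = v].

(** By [Sol_eq] the truth value of [f u = g u] is locally constant in [u]. *)
Lemma sol_unique (J : set R) f g r r' : open J -> connected J ->
  (forall u, J u -> Sol f u /\ Sol g u) -> J r -> J r' -> f r = g r ->
  f r' = g r'.
Proof.
move=> oJ cJ S Jr Jr' fg.
suff <- : (f r = g r) = (f r' = g r') by [].
apply: (@connected_locally_constant _ _ J (fun u => f u = g u)) => // x Jx.
have /Sol_eq : \forall y \near x, Sol f y /\ Sol g y.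
  by near=> y; apply: S; near: y; exact: open_nbhs_nbhs.
by apply: filterS => y fgy _; exact/propext.
Unshelve. all: by end_near. Qed.

Lemma connectedI_real (A B : set R) :
  connected A -> connected B -> connected (A `&` B).
Proof.
move=> /connected_intervalP iA /connected_intervalP iB.
apply/connected_intervalP => x y [Ax Bx] [Ay By] z xzy.
by split; [exact: (iA x y) | exact: (iB x y)].
Qed.

Lemma reach_unique y0 r v v' : reach y0 r v -> reach y0 r v' -> v = v'.
Proof.
move=> [J [f [[oJ cJ J0 Jr] [Sf f0 <-]]]] [K [g [[oK cK K0 Kr] [Sg g0 <-]]]].
apply: (@sol_unique (J `&` K) _ _ 0) => //; rewrite ?f0 ?g0 //.
- exact: openI.
- exact: connectedI_real.
- by move=> u [/Sf ? /Sg].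
Qed.

(** The solution on [J] and [w] agree at [r], hence on the interval [J] meets [W] in, so they glue
    to a solution on the union. *)
Lemma reach_extend y0 (W : set R) w r r' : open W -> connected W ->
  (forall u, W u -> Sol w u) -> W r -> W r' ->
  reach y0 r (w r) -> reach y0 r' (w r').
Proof.
move=> oW cW Sw Wr Wr' [J [f [[oJ cJ J0 Jr] [Sf f0 fr]]]].
have fwE u : J u -> W u -> f u = w u.
  move=> Ju Wu; apply: (@sol_unique (J `&` W) _ _ r) => //.
  - exact: openI.
  - exact: connectedI_real.
  - by move=> t [/Sf ? /Sw].
pose h u := if u \in J then f u else w u.
have hf u : J u -> h u = f u by move=> Ju; rewrite /h mem_set.
have hw u : W u -> h u = w u.
  by move=> Wu; rewrite /h; case: ifPn => // /set_mem Ju; exact: fwE.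
exists (J `|` W), h; split; split.
- exact: openU.
- by apply: connectedU => //; exists r.
- by left.
- by right.
- move=> u [Ju|Wu].
    apply: (@Sol_germ f); last exact: Sf.
    by near=> y; rewrite hf //; near: y; exact: open_nbhs_nbhs.
  apply: (@Sol_germ w); last exact: Sw.
  by near=> y; rewrite hw //; near: y; exact: open_nbhs_nbhs.
- by rewrite hf.
- by rewrite hw.
Unshelve. all: by end_near. Qed.

End continuation.

(* A [Z/2]-valued Cech 1-cocycle on the points of [E], written additively:
   [c x y] is the jump from [x] to a point [y] near [x]. *)
Definition cocycle_at (Z : topologicalType) (E : set Z) (c : Z -> Z -> bool)
    (x y : Z) : Prop :=
  \forall z \near y, E z -> c x z = c x y (+) c y z.

Definition primitive_at (Z : topologicalType) (E : set Z) (c : Z -> Z -> bool)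
    (s : Z -> bool) (x : Z) : Prop :=
  \forall y \near x, E y -> s y = s x (+) c x y.

(** The jumps of [s] and [s'] cancel modulo 2, so their sum is locally constant. *)
Lemma primitive_unique (Z : topologicalType) (A : set Z) (c : Z -> Z -> bool)
    (s s' : Z -> bool) : connected A ->
  (forall x, A x -> primitive_at A c s x) ->
  (forall x, A x -> primitive_at A c s' x) ->
  forall x y, A x -> A y -> s x (+) s' x = s y (+) s' y.
Proof.
move=> cA ps ps' x y Ax Ay.
apply: (@connected_locally_constant _ _ A (fun x => s x (+) s' x)) => // u Au.
apply: filterS2 (ps u Au) (ps' u Au) => v sv s'v Av.
by rewrite sv // s'v //; case: (s u) (s' u) (c u v) => [] [] [].
Qed.

Section primitive_line.
Context {R : realType} (c : R -> R -> bool).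
Hypothesis cP : forall x, \forall y \near x, cocycle_at [set: R] c x y.

Let Sol (s : R -> bool) x := primitive_at [set: R] c s x.

Let Sol_germ f g x : (\forall y \near x, f y = g y) -> Sol f x -> Sol g x.
Proof.
move=> fg; have fgx := nbhs_singleton fg.
by apply: filterS2 fg => y fgy /(_ I) fy _; rewrite -fgy fy fgx.
Qed.

Let Sol_eq f g x : (\forall y \near x, Sol f y /\ Sol g y) ->
  \forall y \near x, f y = g y <-> f x = g x.
Proof.
move=> /nbhs_singleton[Sf Sg].
apply: filterS2 Sf Sg => y /(_ I) -> /(_ I) ->.
by case: (f x) (g x) (c x y) => [] [] [].
Qed.

Lemma primitive_line : exists s : R -> bool,
  forall x, primitive_at [set: R] c s x.
Proof.
(* The cocycle identity with base point [x] says that [c x], up to a constant [b], is itself a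
   primitive near [x]. *)
have local x : exists W : set R, [/\ open W, connected W, W x &
    forall b u, W u -> Sol (fun y => b (+) c x y) u].
  have /nbhs_ballP[e /= e0 He] := cP x.
  exists (ball x e); split.
  - exact: ball_open.
  - rewrite ball_itv; exact/connected_intervalP/interval_is_interval.
  - exact: ballxx.
  - by move=> b u /He; apply: filterS => y /(_ I) -> _; rewrite addbA.
have all_reach x : exists v, reach Sol true x v.
  suff <- : (exists v, reach Sol true 0 v) = (exists v, reach Sol true x v).
    have [W [oW cW W0 SW]] := local 0.
    (* The constant [~~ c 0 0] gives this local primitive the starting value [true] at [0]. *)
    exists true, W, (fun y => (~~ c 0 0) (+) c 0 y).
    by split; split => //; [exact: SW | rewrite addNb addbb | rewrite addNb addbb].
  apply: (@connected_locally_constant _ _ setT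
    (fun x => exists v, reach Sol true x v)) => // [|{}x _].
    exact/connected_intervalP.
  have [W [oW cW Wx SW]] := local x.
  have step r r' : W r -> W r' -> (exists v, reach Sol true r v) ->
      exists v, reach Sol true r' v.
    move=> Wr Wr' [v rv]; exists ((v (+) c x r) (+) c x r').
    (* The constant [v (+) c x r] is the one for which the local primitive takes the value [v] at
       [r]. *)
    apply: (@reach_extend _ _ Sol Sol_germ Sol_eq true W
      (fun y => (v (+) c x r) (+) c x y) r) => //; first exact: SW.
    by rewrite addbK.
  near=> y => _; have Wy : W y by near: y; exact: open_nbhs_nbhs.
  by apply/propext; split; exact: step.
pose s x := projT1 (cid (all_reach x)).
have sP x : reach Sol true x (s x) by exact: projT2 (cid (all_reach x)).
exists s => x; have [J [f [[oJ cJ J0 Jx] [Sf f0 fx]]]] := sP x.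
apply: (@Sol_germ f); last exact: Sf.
near=> y; have Jy : J y by near: y; exact: open_nbhs_nbhs.
by apply: (reach_unique Sol_eq _ (sP y)); exists J, f.
Unshelve. all: by end_near. Qed.

End primitive_line.

Lemma continuous_pair_at (X Y Z : topologicalType) (f : X -> Y) (g : X -> Z)
    (x : X) : {for x, continuous f} -> {for x, continuous g} ->
  {for x, continuous (fun x => (f x, g x))}.
Proof.
by move=> cf cg; apply: (@cvg_pair _ _ _ (nbhs x) (nbhs (f x)) (nbhs (g x))).
Qed.

Lemma near_continuous (X Y : topologicalType) (f : X -> Y) (x : X)
    (P : Y -> Prop) : {for x, continuous f} ->
  (\forall y \near f x, P y) -> \forall z \near x, P (f z).
Proof. by move=> cf /cf. Qed.

(* A function that is a primitive of a cocycle along each fibre of [p], and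
   along the section [sigma], is a primitive on the total space. *)
Section fibration.
Context {Z T : topologicalType} (E : set Z) (p : Z -> T) (sigma : T -> Z).
Context (c : Z -> Z -> bool) (s : Z -> bool).
Hypothesis p_cont : continuous p.
Hypothesis charts : forall x, E x -> exists V : set Z, [/\ open V, V x,
  (forall y, V y -> E y -> cocycle_at E c x y) &
  (forall t, connected (V `&` E `&` p @^-1` [set t]))].
Hypothesis p_open : forall y (W : set Z), E y -> nbhs y W ->
  \forall t \near p y, (W `&` E `&` p @^-1` [set t]) !=set0.
Hypothesis fibre_connected : forall t, connected (E `&` p @^-1` [set t]).
Hypothesis fibre_primitive : forall x, E x ->
  primitive_at (E `&` p @^-1` [set p x]) c s x.
Hypothesis sigma_cont : continuous sigma.
Hypothesis sigma_sect : forall t, E (sigma t) /\ p (sigma t) = t.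
Hypothesis sigma_primitive : forall t,
  \forall t' \near t, s (sigma t') = s (sigma t) (+) c (sigma t) (sigma t').

(** The conclusion holds along [sigma], and whether it holds is locally constant along each fibre;
    as fibres are connected and meet [sigma], it holds everywhere. *)
Lemma fibrewise_primitive x : E x -> primitive_at E c s x.
Proof.
(* In a chart, adding [c x0] removes the jumps of [s] along a fibre, and the slices of the chart are
   connected. *)
have chart_const x0 V t : E x0 -> (forall y, V y -> E y -> cocycle_at E c x0 y) ->
    connected (V `&` E `&` p @^-1` [set t]) ->
    forall y z, V y -> E y -> p y = t -> V z -> E z -> p z = t ->
    s y (+) c x0 y = s z (+) c x0 z.
  move=> Ex0 cV cVt y z Vy Ey pyt Vz Ez pzt.
  apply: (connected_locally_constant (f := fun y => s y (+) c x0 y) cVt);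
    [move=> u [[Vu Eu] /= put] | by [] | by []].
  apply: filterS2 (cV u Vu Eu) (fibre_primitive Eu) => v cxv sv.
  move=> [[Vv Ev] /= pvt]; rewrite cxv // sv ?put //.
  by case: (s u) (c u v) (c x0 u) => [] [] [].
(* If the slice constants are the same [k] for all parameters near [t], then [s] also has the right
   jumps transversally to the fibre. *)
have spread x0 V t k : E x0 -> open V ->
    (forall y, V y -> E y -> cocycle_at E c x0 y) ->
    (\forall t' \near t, forall z, V z -> E z -> p z = t' -> s z (+) c x0 z = k) ->
    forall y, V y -> E y -> p y = t -> primitive_at E c s y.
  move=> Ex0 oV cV dk y Vy Ey pyt.
  have cx0y := cV y Vy Ey.
  have dky : s y (+) c x0 y = k by move/nbhs_singleton: dk; exact.
  rewrite -pyt in dk; have {}dk := p_cont dk.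
  near=> z.
  have Vz : V z by near: z; exact: open_nbhs_nbhs.
  have cz : E z -> c x0 z = c x0 y (+) c y z by near: z.
  have dz w : V w -> E w -> p w = p z -> s w (+) c x0 w = k.
    by move: w; near: z; exact: dk.
  move=> Ez; have := dz z Vz Ez erefl; rewrite cz // -dky.
  by case: (s y) (s z) (c x0 y) (c y z) => [] [] [] [].
have section_good t : primitive_at E c s (sigma t).
  have [Est pst] := sigma_sect t.
  have [V [oV Vs cV cVt]] := charts Est.
  apply: (spread _ V t (s (sigma t) (+) c (sigma t) (sigma t)) Est) => //.
  near=> t' => z Vz Ez pz; have [Est' pst'] := sigma_sect t'.
  have Vs' : V (sigma t').
    by near: t'; apply: sigma_cont; exact: open_nbhs_nbhs.
  have <- := chart_const _ V t' Est cV (cVt t') (sigma t') z Vs' Est' pst' Vz Ez pz.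
  have -> : s (sigma t') = s (sigma t) (+) c (sigma t) (sigma t').
    by near: t'; exact: sigma_primitive.
  have := nbhs_singleton (cV _ Vs Est) Est.
  by rewrite addbb => ->; rewrite addbK addbF.
move=> Ex; have [Est pst] := sigma_sect (p x).
suff <- : primitive_at E c s (sigma (p x)) = primitive_at E c s x.
  exact: section_good.
apply: (connected_locally_constant (f := primitive_at E c s)
  (@fibre_connected (p x))) => // {}x0 [Ex0 /= px0].
have [V [oV Vx0 cV cVt]] := charts Ex0.
(* A primitive at [y] fixes the slice constants near [y]; by [p_open] every nearby slice has a point
   there, so the constants agree on whole slices, including those near [y']. *)
have transport y y' : V y -> E y -> V y' -> E y' -> p y = p y' ->
    primitive_at E c s y -> primitive_at E c s y'.
  move=> Vy Ey Vy' Ey' pyy' sy.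
  apply: (spread x0 V (p y') (s y (+) c x0 y)) => //.
  rewrite -pyy'.
  have : nbhs y (V `&` [set z | E z -> s z (+) c x0 z = s y (+) c x0 y]).
    apply: filterI; first exact: open_nbhs_nbhs.
    apply: filterS2 (cV y Vy Ey) sy => z cz sz Ez /=; rewrite cz // sz //.
    by case: (s y) (c x0 y) (c y z) => [] [] [].
  move=> /(p_open Ey); apply: filterS => t [w [[[Vw /= dw] Ew] /= pw]] z Vz Ez pz.
  by rewrite -dw // (chart_const x0 V t Ex0 cV (cVt t) z w).
near=> y => -[Ey /= py]; have Vy : V y by near: y; exact: open_nbhs_nbhs.
by apply/propext; split; apply: transport; rewrite // py px0.
Unshelve. all: by end_near. Qed.

End fibration.

Lemma primitive_plane (R : realType) (c : R * R -> R * R -> bool) :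
  (forall x, \forall y \near x, cocycle_at [set: R * R] c x y) ->
  exists s : R * R -> bool, forall x, primitive_at [set: R * R] c s x.
Proof.
move=> cP.
have horizontal_cont (v : R) : continuous (fun u : R => (u, v)).
  by move=> u; apply: continuous_pair_at; [exact: cvg_id | exact: cvg_cst].
have vertical_cont (u : R) : continuous (fun v : R => (u, v)).
  by move=> v; apply: continuous_pair_at; [exact: cvg_cst | exact: cvg_id].
have pull (i : R -> R * R) : continuous i -> forall u, \forall v \near u,
    cocycle_at [set: R] (fun u v => c (i u) (i v)) u v.
  move=> ci u; apply: filterS (near_continuous (ci u) (cP (i u))) => v cv.
  by apply: filterS (near_continuous (ci v) cv) => w /(_ I) + _.
have [s0 s0P] := primitive_line (pull _ (horizontal_cont 0)).
have /choice[sv svP] u := primitive_line (pull _ (vertical_cont u)).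
(* The vertical primitives are shifted so as to agree with [s0] on the horizontal axis, which serves
   as the section. *)
pose s (z : R * R) := sv z.1 z.2 (+) sv z.1 0 (+) s0 z.1.
exists s => z.
apply: (@fibrewise_primitive _ _ setT fst (fun u => (u, 0)) c s) => //=.
- by move=> x; exact: cvg_fst.
- move=> x _; have /nbhs_ballP[e /= e0 He] := cP x.
  exists (ball x e); split => //.
  + exact: ball_open.
  + exact: ballxx.
  + by move=> y /He.
  + move=> t; rewrite setIT.
    have [xt|xt] := pselect (ball x.1 e t).
      rewrite (_ : _ `&` _ = (fun v => (t, v)) @` ball x.2 e).
        apply: connected_continuous_connected.
          by rewrite ball_itv; exact/connected_intervalP/interval_is_interval.
        exact: continuous_subspaceT (vertical_cont t).
      apply/seteqP; split => [[u v] [[/= xu xv] /= <-]|[u v] [w /= xw [<- <-]]].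
        by exists v.
      by split.
    rewrite (_ : _ `&` _ = set0); first exact: connected0.
    by apply/seteqP; split => // -[u v] [[/= xu xv] /= ut]; rewrite ut in xu.
- move=> [u v] W _ Wy.
  apply: filterS (near_continuous (horizontal_cont v u) Wy) => t Wt.
  by exists (t, v).
- move=> t; rewrite setTI (_ : _ @^-1` _ = (fun v => (t, v)) @` setT).
    apply: connected_continuous_connected.
      exact/connected_intervalP.
    exact: continuous_subspaceT (vertical_cont t).
  apply/seteqP; split => [[u v] /= <-|[u v] [w /= _ [<- _]]] //.
  by exists v.
- move=> [u v] _.
  have snd_cont : {for (u, v), continuous (snd : R * R -> R)} by exact: cvg_snd.
  apply: filterS (near_continuous snd_cont (svP u v)) => -[u' v'] /= sE [_ /= u'u].
  by rewrite u'u /s /= sE //; case: (sv u v) (sv u 0) (s0 u) (c _ _) => [] [] [] [].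
- move=> t; have := s0P t; apply: filterS => t' /(_ I) s0E.
  by rewrite /s /= !addbb !addFb.
Qed.

(** * The inverse function theorem *)

Lemma mx_norm_leP (R : realType) m n (M : 'M[R]_(m, n)) (e : R) : 0 <= e ->
  `|M| <= e <-> forall i j, `|M i j| <= e.
Proof.
move=> e0; rewrite {1}/Num.Def.normr/= mx_normrE; split=> [Me i j|Me].
  by apply: le_trans Me; exact: (le_bigmax _ (fun ij => `|M ij.1 ij.2|) (i, j)).
exact: bigmax_le.
Qed.

Lemma ball_convex (R : realType) (V : normedModType R) (x y z : V) (r t : R) :
  ball x r y -> ball x r z -> 0 <= t -> t <= 1 -> ball x r (z + t *: (y - z)).
Proof.
rewrite -!ball_normE /= => By Bz t0 t1.
have -> : x - (z + t *: (y - z)) = (1 - t) *: (x - z) + t *: (x - y).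
  rewrite scalerBl scale1r -addrA [- _ + _]addrC -scalerBr.
  rewrite (_ : x - y - _ = z - y); last by rewrite opprB addrC subrKA.
  by rewrite opprD addrA -scalerN opprB.
rewrite (le_lt_trans (ler_normD _ _)) // !normrZ ger0_norm ?subr_ge0 // ger0_norm //.
have [->|tn0] := eqVneq t 0; first by rewrite subr0 mul1r mul0r addr0.
rewrite [ltRHS](_ : r = (1 - t) * r + t * r); last by rewrite -mulrDl subrK mul1r.
apply: ler_ltD.
  by rewrite ler_wpM2l ?subr_ge0 // ltW.
by rewrite ltr_pM2l // lt_neqAle eq_sym tn0.
Qed.

(** The norm of a row vector is its largest absolute entry, so the scalar mean value theorem,
    applied to each coordinate along the segment from [z] to [y], suffices. *)
Lemma lipschitz_diff (R : realType) (V : normedModType R) m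
    (f : V -> 'rV[R]_m) (x0 : V) (r k : R) : 0 <= k ->
  (forall p, ball x0 r p -> differentiable f p) ->
  (forall p v, ball x0 r p -> `|'d f p v| <= k * `|v|) ->
  forall y z, ball x0 r y -> ball x0 r z -> `|f y - f z| <= k * `|y - z|.
Proof.
move=> k0 df dfk y z By Bz.
apply/mx_norm_leP => [|i j]; first exact: mulr_ge0.
rewrite (ord1 i) {i}.
pose g (t : R) := z + t *: (y - z).
have dg t : is_diff t g ( *:%R^~ (y - z)).
  rewrite (_ : *:%R^~ (y - z) = 0 + ( *:%R^~ (y - z))); last by rewrite add0r.
  exact: is_diffD.
have Bg (t : R) : t \in `[0, 1]%R -> ball x0 r (g t).
  by rewrite in_itv /= => /andP[t0 t1]; exact: ball_convex.
have dfg (t : R) : t \in `[0, 1]%R ->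
    is_derive t 1 (fun t => f (g t) 0 j) ('d f (g t) (y - z) 0 j).
  move=> t01.
  have dgt := dg t.
  have dft := df _ (Bg _ t01).
  have dfgt : differentiable (f \o g) t by exact: differentiable_comp.
  have Dfg : derivable (f \o g) t 1 by exact: diff_derivable.
  have /derivable_mxP Dj := Dfg.
  apply: DeriveDef; first exact: (Dj 0 j).
  have := derive_mx Dfg.
  move=> /(congr1 (fun M : 'rV[R]_m => M 0 j)); rewrite mxE => <-.
  by rewrite deriveE // diff_comp //= diff_val scale1r.
pose F (t : R) : R := f (g t) 0 j; pose dF (t : R) : R := 'd f (g t) (y - z) 0 j.
have Fcont : {within `[0, 1], continuous F}.
  by apply: derivable_within_continuous => t /dfg [].
have dFP (t : R) : t \in `]0, 1[%R -> is_derive t 1 F (dF t).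
  by move=> t01; apply: dfg; exact: subset_itv_oo_cc.
have [t t01 FE] := MVT_segment ler01 dFP Fcont.
have := Bg t t01.
move=> Bt; rewrite subr0 mulr1 /F /g scale1r scale0r addr0 (addrC z) subrK in FE.
rewrite !mxE FE.
have : `|'d f (g t) (y - z)| <= k * `|y - z| by exact: dfk.
by move/mx_norm_leP; apply; exact: mulr_ge0.
Qed.

(** The image of [V] is a whole ball, so that its traces on lines and planes are convex and their
    images under [g] are connected. *)
Definition inverse_chart (R : realType) (E : normedModType R) (F : E -> E)
    (x : E) (V : set E) (d : R) (g : E -> E) :=
  [/\ open V, V x, 0 < d,
      (forall y, V y -> ball (F x) d (F y) /\ g (F y) = y) &
      (forall w, ball (F x) d w ->
         [/\ V (g w), F (g w) = w & {for w, continuous g}])].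

Lemma strict_diff_inverse (R : realType) (E : completeNormedModType R)
    (F : E -> E) (L K : {linear E -> E}) (M : R) (x : E) (N : set E) :
  continuous F -> cancel L K -> cancel K L -> 0 < M -> (forall u, `|K u| <= M * `|u|) ->
  (forall e, 0 < e -> exists2 r, 0 < r & forall y z,
     ball x r y -> ball x r z ->
     `|F y - F z - L (y - z)| <= e * `|y - z|) ->
  nbhs x N -> exists V d g, inverse_chart F x V d g /\ V `<=` N.
Proof.
move=> Fc LK KL M0 leK strict xN.
(* Chosen so that the contraction factor [M * e] is one half. *)
pose e := (2 * M)^-1.
have e0 : 0 < e by rewrite invr_gt0 mulr_gt0.
have Me : M * e = 2^-1.
  by rewrite /e invfM mulrCA mulfV ?mulr1 // gt_eqF.
have [r1 r1_gt0 strict1] := strict e e0.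
have /nbhs_ballP[r2 /= r2_gt0 xr2] := xN.
pose r := Num.min r1 r2.
have r0 : 0 < r by rewrite lt_min r1_gt0.
have Br1 y : ball x r y -> ball x r1 y by apply: le_ball; rewrite ge_min lexx.
have Br2 y : ball x r y -> N y.
  by move=> Bry; apply: xr2; apply: le_ball Bry; rewrite ge_min lexx orbT.
(* [F y = w] is solved by the fixed points of [y - K (F y - w)]. *)
have contr y z : ball x r y -> ball x r z ->
    `|(y - z) - K (F y - F z)| <= 2^-1 * `|y - z|.
  move=> /Br1 By /Br1 Bz.
  have -> : y - z - K (F y - F z) = - K (F y - F z - L (y - z)).
    by rewrite [in RHS]linearB LK opprB.
  rewrite normrN (le_trans (leK _)) // -Me -mulrA (ler_wpM2l (ltW M0)) //.
  exact: strict1.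
(* This estimate yields both the injectivity of [F] near [x] and the continuity of the inverse. *)
have inj y z : ball x r y -> ball x r z -> `|y - z| <= 2 * M * `|F y - F z|.
  move=> By Bz.
  have := contr y z By Bz; have := leK (F y - F z).
  have := ler_normD (y - z - K (F y - F z)) (K (F y - F z)); rewrite subrK.
  lra.
(* Since [M * d = r / 4], the map [T] below moves [x] by less than [r / 4]; contraction adds at most
   [r / 4], so the closed ball of radius [r / 2] is preserved. *)
pose d := r / (4 * M).
have d0 : 0 < d by rewrite divr_gt0 // mulr_gt0.
have sub_r y : ball x (r / 2) y -> ball x r y by apply: le_ball; lra.
have surj w : ball (F x) d w -> exists y, ball x (r / 2) y /\ F y = w.
  move=> Bw.
  pose U : set E := closed_ball_ Num.norm x (r / 2).
  pose T (y : E) : E := y - K (F y - w).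
  have Ur y : U y -> ball x r y.
    by rewrite -ball_normE /U /closed_ball_ /= => Uy; lra.
  have TB y z : U y -> U z -> `|T y - T z| <= 2^-1 * `|y - z|.
    move=> /Ur Uy /Ur Uz; rewrite /T.
    rewrite (_ : _ - _ = (y - z) - K (F y - F z)); first exact: contr.
    by rewrite opprD addrACA -opprD -linearB opprB subrKA.
  have Ux : U x by rewrite /U /closed_ball_ /= subrr normr0; lra.
  have Kw : `|K (F x - w)| < r / 4.
    rewrite (le_lt_trans (leK _)) // mulrC -ltr_pdivlMr // -mulrA -invfM.
    by move: Bw; rewrite -ball_normE.
  have TU : {homo T : y / U y}.
    move=> y Uy; rewrite /U /closed_ball_ /=.
    have -> : x - T y = (T x - T y) + K (F x - w).
      by rewrite {2}/T addrAC subrK.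
    have := TB _ _ Ux Uy; move: (Uy) Kw; rewrite {1}/U /closed_ball_ /=.
    have := ler_normD (T x - T y) (K (F x - w)); lra.
  have [] := @banach_fixed_point R _ U [fun of mkfun TU].
  - exists (2^-1)%:nng; split => /=; first lra.
    by move=> [y z] [Uy Uz] /=; exact: TB.
  - exact: closed_closed_ball_.
  - by exists x.
  move=> y Uy; rewrite /= /mkfun /T => yE; exists y.
  have Fy : F y = w.
    have : K (F y - w) = 0 by rewrite -[LHS](subKr y) -yE subrr.
    by move/(congr1 L); rewrite KL linear0 => /subr0_eq.
  (* The fixed point is even in the open ball, because half its distance to [x] is less than
     [r / 4]. *)
  split => //; rewrite -ball_normE /= distrC.
  have := contr y x (Ur _ Uy) (Ur _ Ux).
  have -> : F y - F x = - (F x - w) by rewrite Fy opprB.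
  have := ler_normB (y - x - K (- (F x - w))) (K (F x - w)).
  rewrite linearN opprK addrK; lra.
pose g w := xget x [set y | ball x (r / 2) y /\ F y = w].
have gP w : ball (F x) d w -> ball x (r / 2) (g w) /\ F (g w) = w.
  by move=> /surj; exact: xgetPex.
(* Intersecting with the preimage makes the image exactly the ball of radius [d]. *)
exists (ball x (r / 2) `&` F @^-1` ball (F x) d), d, g; split; last first.
  by move=> y [/sub_r/Br2].
split => //.
- apply: openI; first exact: ball_open.
  by apply: open_comp => [? _|]; [exact: Fc | exact: ball_open].
- by split => /=; apply: ballxx => //; rewrite divr_gt0.
- move=> y [/= By BFy]; split => //; have [Bg Fg] := gP _ BFy.
  apply/eqP; rewrite -subr_eq0 -normr_le0.
  by rewrite (le_trans (inj _ _ (sub_r _ Bg) (sub_r _ By))) // Fg subrr normr0 mulr0.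
- move=> w Bw; have [Bg Fg] := gP _ Bw.
  split => //; first by split => //=; rewrite Fg.
  apply/cvgrPdist_le => eps eps0.
  have eps0' : 0 < eps / (2 * M) by rewrite divr_gt0 // mulr_gt0.
  near=> w'.
  have Bw' : ball (F x) d w'.
    by near: w'; apply: open_nbhs_nbhs; split => //; exact: ball_open.
  have [Bg' Fg'] := gP _ Bw'.
  rewrite (le_trans (inj _ _ (sub_r _ Bg) (sub_r _ Bg'))) // Fg Fg'.
  rewrite mulrC -ler_pdivlMr ?mulr_gt0 //.
Unshelve. all: by end_near. Qed.

Lemma mulmx_norm_le (R : realType) m n p (M : 'M[R]_(m, n)) (N : 'M[R]_(n, p)) :
  `|M *m N| <= n%:R * `|N| * `|M|.
Proof.
apply/mx_norm_leP => [|i j]; first by rewrite !mulr_ge0.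
have leM := (mx_norm_leP M (normr_ge0 M)).1 (lexx _).
have leN := (mx_norm_leP N (normr_ge0 N)).1 (lexx _).
rewrite mxE (le_trans (ler_norm_sum _ _ _)) //.
have -> : n%:R * `|N| * `|M| = \sum_(k < n) `|N| * `|M|.
  by rewrite sumr_const card_ord -mulrA mulr_natl.
by apply: ler_sum => k _; rewrite normrM mulrC ler_pM ?leM ?leN.
Qed.

Lemma linear_norm_le_basis (R : realType) n (W : normedModType R)
    (f g : {linear 'rV[R]_n -> W}) (e : R) :
  (forall i, `|f (delta_mx 0 i) - g (delta_mx 0 i)| <= e) ->
  forall v : 'rV[R]_n, `|f v - g v| <= n%:R * e * `|v|.
Proof.
move=> fge v.
have expand (h : {linear 'rV[R]_n -> W}) :
    h v = \sum_i v 0 i *: h (delta_mx 0 i).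
  rewrite {1}(row_sum_delta v) linear_sum /=.
  by apply: eq_bigr => i _; rewrite linearZ.
rewrite (expand f) (expand g) -sumrB.
under eq_bigr do rewrite -scalerBr.
rewrite (le_trans (ler_norm_sum _ _ _)) //.
have -> : n%:R * e * `|v| = \sum_(k < n) `|v| * e.
  by rewrite sumr_const card_ord -mulrA mulr_natl mulrC.
apply: ler_sum => i _; rewrite normrZ ler_pM //.
exact: (mx_norm_leP v (normr_ge0 v)).1 (lexx _) 0 i.
Qed.

(** [Ck] controls the differential on one fixed vector at a time; the finitely many basis vectors
    turn this into a bound uniform in [v]. *)
Lemma diff_near (R : realType) n m (E := 'rV[R]_n : normedModType R)
    (F : E -> 'rV[R]_m) (x : E) (e : R) : Ck 1 [set: E] F -> 0 < e ->
  \forall p \near x, forall v, `|'d F p v - 'd F x v| <= e * `|v|.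
Proof.
move=> [_ dFc] e0.
(* This gives [n * eta <= e]; the summand 1 covers [n = 0]. *)
pose eta := e / (n%:R + 1).
have eta0 : 0 < eta by rewrite divr_gt0 // ltr_wpDl.
have near_entry (i : 'I_n) : \forall p \near x,
    `|'d F p (delta_mx 0 i) - 'd F x (delta_mx 0 i)| <= eta.
  by have /cvgrPdistC_le := dFc (delta_mx 0 i) x I; exact.
have near_entries := filter_forall (nbhs_filter x) near_entry.
apply: filterS near_entries => p Hp v.
apply: le_trans (linear_norm_le_basis Hp v) _; apply: ler_wpM2r => //.
by rewrite /eta mulrCA ler_piMr ?ltW // ltr_pdivrMr ?mul1r ?ltrDl // ltr_wpDl.
Qed.

(* Completes the [completeNormedModType] join on matrices. *)
HB.instance Definition _ (R : realType) (m n : nat) :=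
  Uniform_isComplete.Build 'M[R]_(m, n) (@cauchy_cvg _).

Lemma local_inverse (R : realType) n (E := 'rV[R]_n : normedModType R)
    (F : E -> E) (x : E) (N : set E) : local_diffeomorphism F -> nbhs x N ->
  exists V d g, @inverse_chart R E F x V d g /\ V `<=` N.
Proof.
move=> [smF bijF] xN.
have dF (p : E) : differentiable F p by have [dF _] := smF 1%N; exact: dF.
pose K := invmx (lin1_mx ('d F x)).
have JK : cancel ('d F x) (mulmxr K).
  move=> v; rewrite /= -mul_rV_lin1 mulmxK //.
  have [h hK Kh] := bijF x.
  rewrite -row_free_unit -kermx_eq0; apply/rowV0P => u /sub_kermxP.
  rewrite mul_rV_lin1 => Fu0; apply: (can_inj hK).
  by rewrite Fu0 linear0.
have KJ : cancel (mulmxr K) ('d F x).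
  have [h hK Kh] := bijF x.
  by move=> v; rewrite -{1}(Kh v) JK Kh.
pose M := n%:R * `|K| + 1.
have M0 : 0 < M by rewrite ltr_wpDl // mulr_ge0.
pose E' : completeNormedModType R := 'rV[R]_n.
have H := @strict_diff_inverse R E' F ('d F x) (mulmxr K) M x N.
apply: H => //.
- by move=> p; exact: differentiable_continuous.
- move=> u; apply: le_trans (mulmx_norm_le _ _) _.
  by rewrite ler_wpM2r // /M lerDl.
move=> e e0; have /nbhs_ballP[r /= r0 Hr] := diff_near x (smF 1%N) e0.
exists r => // y z By Bz.
(* Strict differentiability is the mean value estimate for [G], whose differential is small near
   [x]. *)
pose G y := F y - 'd F x y.
have dxc : continuous ('d F x) by exact: diff_continuous.
have dG (p : E) : is_diff p G (('d F p : E -> E) - ('d F x : E -> E)).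
  apply: is_diffB; first exact: differentiableP.
  by apply: DiffDef; [exact: linear_differentiable | exact: diff_lin].
have -> : F y - F z - 'd F x (y - z) = G y - G z.
  by rewrite linearB /= /G !opprB addrACA [RHS]addrACA (addrC (- F z)).
apply: lipschitz_diff By Bz; first exact: ltW.
  by move=> p _; case: (dG p).
by move=> p v /Hr Hp; rewrite diff_val; exact: Hp.
Qed.

(** * Leaves and pencils of planes *)

Lemma convex_connected (R : realType) (E : normedModType R) (A : set E) :
  (forall x y t, A x -> A y -> 0 <= t -> t <= 1 -> A (x + t *: (y - x))) ->
  connected A.
Proof.
move=> cA; have [[x Ax]|A0] := pselect (A !=set0); last first.
  suff -> : A = set0 by exact: connected0.
  by apply/seteqP; split => // y Ay; case: A0; exists y.
have -> : A = \bigcup_(y in A) ((fun t : R => x + t *: (y - x)) @` `[0, 1]).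
  apply/seteqP; split => [y Ay|z [y Ay] [t /= + <-]].
    exists y => //; exists 1; last by rewrite scale1r addrC subrK.
    by rewrite /= in_itv /= lexx ler01.
  by rewrite in_itv /= => /andP[t0 t1]; exact: cA.
apply: bigcup_connected => [|y Ay].
  exists x => y Ay; exists 0; last by rewrite scale0r addr0.
  by rewrite /= in_itv /= lexx ler01.
apply: connected_continuous_connected; first exact: segment_connected.
apply: continuous_subspaceT => t.
apply: cvgD; first exact: cvg_cst.
by apply: cvgZl; exact: cvg_id.
Qed.

Section leaf.
Context {R : realType} {E : normedModType R} (F : E -> E).
Context (q e : E) (lam : E -> R).
Hypothesis F_cont : continuous F.
Hypothesis F_chart : forall x (N : set E), nbhs x N ->
  exists V d g, inverse_chart F x V d g /\ V `<=` N.
Hypothesis lam_cont : continuous lam.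
Hypothesis lamK : forall u : R, lam (q + u *: e) = u.

Definition lifts_line (f : R -> E) (u : R) : Prop :=
  {for u, continuous f} /\ F (f u) = q + u *: e.

Lemma lifts_line_germ f g u :
  (\forall v \near u, f v = g v) -> lifts_line f u -> lifts_line g u.
Proof.
move=> fg [fc Ff]; have fgu := nbhs_singleton fg; split; last by rewrite -fgu.
move=> W; rewrite -fgu => /fc fW.
by apply: filterS2 fg fW => v /= <-.
Qed.

(** If the lifts meet at [u], both stay in a chart, on which [F] is injective; if not, continuity
    keeps them apart. *)
Lemma lifts_line_eq f g u :
  (\forall v \near u, lifts_line f v /\ lifts_line g v) ->
  \forall v \near u, f v = g v <-> f u = g u.
Proof.
move=> fgu; have [[fc Ff] [gc Fg]] := nbhs_singleton fgu.
have [fgE|fgN] := pselect (f u = g u).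
  have [V [d [k [[oV Vf _ kP _] _]]]] := F_chart (filterT : nbhs (f u) setT).
  have Vg : V (g u) by rewrite -fgE.
  near=> v; split => // _.
  have [[_ Ffv] [_ Fgv]] : lifts_line f v /\ lifts_line g v by near: v.
  have Vfv : V (f v).
    by near: v; apply: (near_continuous fc); exact: open_nbhs_nbhs.
  have Vgv : V (g v).
    by near: v; apply: (near_continuous gc); exact: open_nbhs_nbhs.
  by rewrite -(kP _ Vfv).2 -(kP _ Vgv).2 Ffv Fgv.
have e0 : 0 < `|f u - g u| / 2 by rewrite divr_gt0 // normr_gt0 subr_eq0; exact/eqP.
near=> v; split => // fgv; exfalso.
have : `|f u - f v| < `|f u - g u| / 2.
  by near: v; exact: cvgr_dist_lt fc _ e0.
have : `|g u - g v| < `|f u - g u| / 2.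
  by near: v; exact: cvgr_dist_lt gc _ e0.
rewrite -fgv (distrC (g u)) => lt1 lt2.
have := ler_distD (f v) (f u) (g u); lra.
Unshelve. all: by end_near. Qed.

(* The leaf through [a] of the preimage of the line [q + R e]. *)
Definition leaf (a : E) : set E := [set x | exists u, reach lifts_line a u x].

Lemma leaf_line a x : leaf a x -> exists u, F x = q + u *: e.
Proof.
by move=> [u [J [f [[_ _ _ Ju] [Sf _ <-]]]]]; exists u; have [] := Sf u Ju.
Qed.

(** Applying [lam] shows that [b] is reached at parameter [0], where the lift has the value [a]. *)
Lemma leaf_base a b : leaf a b -> F b = q -> a = b.
Proof.
move=> [u [J [f [[_ _ _ Ju] [Sf <- <-]]]]]; have [_ ->] := Sf u Ju.
move=> /(congr1 lam); rewrite lamK -{1}[q]addr0 -(scale0r e) lamK.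
by move=> ->.
Qed.

Lemma chart_lifts x V d g : inverse_chart F x V d g ->
  let W := [set u : R | ball (F x) d (q + u *: e)] in
  [/\ open W, connected W & forall u, W u ->
      lifts_line (fun u => g (q + u *: e)) u].
Proof.
move=> [oV Vx d0 gK gP] W.
have line_cont : continuous (fun u : R => q + u *: e).
  by move=> u; apply: cvgD; [exact: cvg_cst | apply: cvgZl; exact: cvg_id].
split.
- by apply: open_comp => [u _|]; [exact: line_cont | exact: ball_open].
- apply: convex_connected => u v t Wu Wv t0 t1; rewrite /W /=.
  have -> : q + (u + t *: (v - u)) *: e =
      (q + u *: e) + t *: ((q + v *: e) - (q + u *: e)).
    by rewrite opprD addrACA subrr add0r -scalerBl scalerA -addrA -scalerDl.
  exact: ball_convex.
- move=> u Wu; have [Vg Fg gc] := gP _ Wu; split => //.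
  by apply: continuous_comp; [exact: line_cont | exact: gc].
Qed.

(** Off the preimage of the line there is nothing to check nearby. On it, a chart contains one lift
    through all of its points over the line, so reaching one of them reaches the others; [lam]
    identifies the parameters. *)
Lemma leaf_clopen a x : \forall y \near x,
  (exists u, F y = q + u *: e) -> leaf a y <-> leaf a x.
Proof.
have [[u0 Fx]|nline] := pselect (exists u, F x = q + u *: e); last first.
  have Fx : F x - (q + lam (F x) *: e) != 0.
    by apply/eqP => /subr0_eq Fx; apply: nline; exists (lam (F x)).
  have c : continuous (fun y => F y - (q + lam (F y) *: e)).
    move=> y; apply: cvgB; first exact: F_cont.
    apply: cvgD; first exact: cvg_cst.
    by apply: cvgZl; apply: continuous_comp; [exact: F_cont | exact: lam_cont].
  have : \forall y \near x, F y - (q + lam (F y) *: e) != 0.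
    exact: cvgr_neq0 (c x) Fx.
  by apply: filterS => y + [u Fy]; rewrite Fy lamK subrr eqxx.
have [V [d [g [ch _]]]] := F_chart (filterT : nbhs x setT).
have [oW cW SW] := chart_lifts ch.
have [oV Vx d0 gK gP] := ch.
have step y z : V y -> V z -> (exists u, F y = q + u *: e) ->
    (exists u, F z = q + u *: e) -> leaf a y -> leaf a z.
  move=> Vy Vz [u Fy] [v Fz] [u' ry].
  have [BFy gy] := gK y Vy; have [BFz gz] := gK z Vz.
  have uu' : u' = u.
    move: ry => [J [f [[_ _ _ Ju] [Sf _ fy]]]]; have [_] := Sf u' Ju.
    by rewrite fy Fy => /(congr1 lam); rewrite !lamK.
  exists v; rewrite -gz Fz.
  apply: (reach_extend lifts_line_germ lifts_line_eq oW cW SW (r := u)).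
  - by rewrite /= -Fy.
  - by rewrite /= -Fz.
  - by rewrite -Fy gy -uu'.
near=> y => Fy; have Vy : V y by near: y; exact: open_nbhs_nbhs.
by split; apply: step => //; exists u0.
Unshelve. all: by end_near. Qed.

Lemma leaf_refl a : F a = q -> leaf a a.
Proof.
move=> Fa; have [V [d [g [ch _]]]] := F_chart (filterT : nbhs a setT).
have [oW cW SW] := chart_lifts ch.
have [oV Vx d0 gK gP] := ch.
have ga : g (q + 0 *: e) = a.
  by rewrite scale0r addr0 -Fa; have [] := gK a Vx.
have W0 : ball (F a) d (q + 0 *: e) by rewrite scale0r addr0 Fa; exact: ballxx.
by exists 0, [set u : R | ball (F a) d (q + u *: e)],
  (fun u => g (q + u *: e)); split; split.
Qed.

End leaf.

(** [phi] is a total function, so its continuity on [S] is expressed by neighbourhoods relative to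
    [S]. *)
Definition plane_like (R : realType) (E : normedModType R) (S : set E) :=
  exists (phi : E -> R * R) (psi : R * R -> E),
  [/\ continuous psi, (forall z, S (psi z)),
      (forall x, S x -> psi (phi x) = x) &
      (forall x W, S x -> nbhs (phi x) W -> \forall y \near x, S y -> W (phi y))].

Lemma plane_like_connected (R : realType) (E : normedModType R) (S : set E) :
  plane_like S -> connected S.
Proof.
move=> [phi [psi [psi_cont Spsi phiK _]]].
have -> : S = psi @` setT.
  apply/seteqP; split => [x Sx|_ [z _ <-]]; last exact: Spsi.
  by exists (phi x); rewrite ?phiK.
apply: connected_continuous_connected; last exact: continuous_subspaceT.
by apply: convex_connected.
Qed.

(** The cocycle is pulled back to the plane along [psi], and its primitive is brought back along
    [phi]. *)
Lemma plane_like_primitive (R : realType) (E : normedModType R) (S : set E)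
    (c : E -> E -> bool) : plane_like S ->
  (forall x, S x -> \forall y \near x, S y -> cocycle_at S c x y) ->
  exists s, forall x, S x -> primitive_at S c s x.
Proof.
move=> [phi [psi [psi_cont Spsi phiK phi_cont]]] cP.
have [|s sP] := @primitive_plane R (fun z w => c (psi z) (psi w)).
  move=> z; apply: filterS (near_continuous (psi_cont z) (cP _ (Spsi z))) => w cw.
  apply: filterS (near_continuous (psi_cont w) (cw (Spsi w))) => v cv _.
  exact: cv.
exists (s \o phi) => x Sx; apply: filterS (phi_cont x _ Sx (sP (phi x))) => y + Sy.
by move=> /(_ Sy I) /=; rewrite !phiK.
Qed.

(** * Separation by a leaf in a pencil of planes *)

Section pencil.
Context {R : realType} {E : normedModType R} (F : E -> E).
Context (q e : E) (nu : R -> E) (lam : E -> R) (h : R -> E -> R) (kappa : R -> R).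
Hypothesis F_cont : continuous F.
Hypothesis F_chart : forall x (N : set E), nbhs x N ->
  exists V d g, inverse_chart F x V d g /\ V `<=` N.
Hypothesis lam_cont : continuous lam.
Hypothesis lamK : forall u : R, lam (q + u *: e) = u.
Hypothesis nu_cont : continuous nu.
Hypothesis h_cont : continuous (fun z : E * R => h z.2 z.1).
Hypothesis h_plane : forall t alpha beta,
  h t (q + alpha *: e + beta *: nu t) = beta * kappa t.
Hypothesis kappa_gt0 : forall t, 0 < kappa t.
Hypothesis h_flip : forall y, h 1 y = - h (-1) y.
Hypothesis nu_flip : nu 1 = - nu (-1).

Definition pencil_plane (t : R) : set E :=
  [set y | exists alpha beta : R, y = q + alpha *: e + beta *: nu t].

Hypothesis planes : forall t, plane_like (F @^-1` pencil_plane t).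

Context (a b : E) (Fa : F a = q) (Fb : F b = q).

Local Notation L := (leaf F q e a).
Local Notation incidence := [set z : E * R | pencil_plane z.2 (F z.1)].

(** On each plane [h] is a positive multiple of the [nu]-coordinate. A primitive of this cocycle is
    locally constant off [L], takes on [L] the value of the side [h > 0], and changes value on the
    side [h < 0]. *)
Definition crossing (z w : E * R) : bool := `[< L z.1 >] && (h w.2 (F w.1) < 0).

Lemma pencil_plane_center t : pencil_plane t q.
Proof. by exists 0, 0; rewrite !scale0r !addr0. Qed.

Lemma h_line t u : h t (q + u *: e) = 0.
Proof.
by have := h_plane t u 0; rewrite scale0r addr0 mul0r.
Qed.

Lemma h_eq0 t y : pencil_plane t y -> h t y = 0 -> exists u, y = q + u *: e.
Proof.
move=> [alpha [beta ->]]; rewrite h_plane => /eqP.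
rewrite mulf_eq0 (gt_eqF (kappa_gt0 t)) orbF => /eqP ->.
by exists alpha; rewrite scale0r addr0.
Qed.

Lemma incidence_cont (t : R) : continuous (fun x : E => (x, t)).
Proof. by move=> x; apply: continuous_pair_at; [exact: cvg_id|exact: cvg_cst]. Qed.

(** The only delicate case is [x] on [L] and [y] off [L]: then [F y] is off the line, so [h] is
    nonzero there and keeps its sign near [(y, t')]. *)
Lemma crossing_cocycle x t y t' : 
  ((exists u, F y = q + u *: e) -> L y <-> L x) -> pencil_plane t' (F y) ->
  cocycle_at incidence crossing (x, t) (y, t').
Proof.
move=> Lyx Py; rewrite /cocycle_at.
have [Lx|Lx] := asboolP (L x); last first.
  have /asboolPn/negbTE Ly : ~ L y.
    by move=> Ly; apply: Lx; apply/Lyx => //; exact: leaf_line Ly.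
  by near=> z => _; rewrite /crossing /= Ly (asboolF Lx).
have [Ly|Ly] := asboolP (L y).
  have [u Fy] := leaf_line Ly.
  near=> z => _.
  by rewrite /crossing /= (asboolT Lx) (asboolT Ly) Fy h_line ltxx.
have hy : h t' (F y) != 0.
  by apply/eqP => /(h_eq0 Py) Fy; apply: Ly; exact/Lyx.
have hFc : continuous (fun z : E * R => h z.2 (F z.1)).
  move=> z; apply: (@continuous_comp _ _ _ (fun z : E * R => (F z.1, z.2))
    (fun z : E * R => h z.2 z.1)); last exact: h_cont.
  apply: continuous_pair_at; last exact: cvg_snd.
  by apply: continuous_comp; [exact: cvg_fst | exact: F_cont].
have [hneg|hpos] := ltP (h t' (F y)) 0.
  have : \forall z \near (y, t'), h z.2 (F z.1) < 0.
    exact: (near_continuous (hFc (y, t')) (lt_nbhsl hneg)).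
  apply: filterS => z zneg _.
  by rewrite /crossing /= (asboolT Lx) (asboolF Ly) zneg hneg.
have {}hpos : 0 < h t' (F y) by rewrite lt_neqAle eq_sym hy.
have : \forall z \near (y, t'), 0 < h z.2 (F z.1).
  exact: (near_continuous (hFc (y, t')) (lt_nbhsr hpos)).
apply: filterS => z zpos _.
by rewrite /crossing /= (asboolT Lx) (asboolF Ly) !ltNge !ltW.
Unshelve. all: by end_near. Qed.

(** Each slice of a chart is the image under [g] of a ball intersected with a plane, which is
    convex. *)
Lemma incidence_chart z : incidence z -> exists V : set (E * R),
  [/\ open V, V z,
      (forall w, V w -> incidence w -> cocycle_at incidence crossing z w) &
      (forall t, connected (V `&` incidence `&` snd @^-1` [set t]))].
Proof.
move: z => [x t0] /= Px.
have [V [d [g [ch VN]]]] :=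
  F_chart (leaf_clopen F_cont F_chart lam_cont lamK a x).
have [oV Vx d0 gK gP] := ch.
exists (fst @^-1` V); split => //.
- by apply: open_comp => [z _|//]; exact: cvg_fst.
- move=> [y t] /= Vy Py; apply: crossing_cocycle => //; exact: VN.
- move=> t.
  have -> : fst @^-1` V `&` incidence `&` snd @^-1` [set t] =
      (fun y => (g y, t)) @` (ball (F x) d `&` pencil_plane t).
    apply/seteqP; split => [[y t'] [[/= Vy Py] /= t't]|].
      rewrite t't in Py *.
      by have [By gy] := gK y Vy; exists (F y) => //; rewrite gy.
    by move=> _ [y [By Py] <-] /=; have [Vg Fg _] := gP y By; rewrite Fg.
  apply: connected_continuous_connected.
    apply: convex_connected => y z u [By Py] [Bz Pz] u0 u1; split.
      exact: ball_convex.
    move: Py Pz => [al [be ->]] [al' [be' ->]].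
    exists (al + u * (al' - al)), (be + u * (be' - be)).
    have -> : q + al' *: e + be' *: nu t - (q + al *: e + be *: nu t) =
        (al' - al) *: e + (be' - be) *: nu t.
      by rewrite opprD addrACA opprD [q + _ + _]addrACA subrr add0r -!scalerBl.
    by rewrite scalerDr !scalerA !(scalerDl e) !(scalerDl (nu t)) !addrA [X in X + _ = _]addrAC.
  apply: continuous_in_subspaceT => y /set_mem[By Py].
  by apply: continuous_pair_at; [have [_ _] := gP y By | exact: cvg_cst].
Qed.

Lemma incidence_open z (W : set (E * R)) : incidence z -> nbhs z W ->
  \forall t \near z.2, (W `&` incidence `&` snd @^-1` [set t]) !=set0.
Proof.
move: z => [y t0] /= [al [be Fy]] Wz.
have [V [d [g [ch _]]]] := F_chart (filterT : nbhs y setT).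
have [oV Vy d0 gK gP] := ch.
(* Freezing the coordinates [al] and [be] carries [F y] continuously into the nearby planes, and [g]
   lifts this path. *)
pose tau t := q + al *: e + be *: nu t.
have tau_cont : continuous tau.
  move=> t; apply: cvgD; first exact: cvg_cst.
  by apply: cvgZr; exact: nu_cont.
have tau0 : tau t0 = F y by [].
have gtau : g (tau t0) = y by rewrite tau0; have [] := gK y Vy.
have Btau0 : ball (F y) d (tau t0) by rewrite tau0; exact: ballxx.
have gtau_cont : {for t0, continuous (fun t => (g (tau t), t))}.
  apply: continuous_pair_at; last exact: cvg_id.
  apply: continuous_comp; first exact: tau_cont.
  by have [] := gP _ Btau0.
near=> t; exists (g (tau t), t).
have Bt : ball (F y) d (tau t).
  near: t; apply: (near_continuous (tau_cont t0)).
  by apply: open_nbhs_nbhs; split => //; exact: ball_open.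
have [_ Fg _] := gP _ Bt; split => //; split.
  by near: t; apply: (near_continuous gtau_cont); rewrite gtau.
by exists al, be; rewrite /= Fg.
Unshelve. all: by end_near. Qed.

Lemma fibre_primitive t : exists s : E -> bool, s a = false /\
  forall x, (F @^-1` pencil_plane t) x ->
    primitive_at (F @^-1` pencil_plane t) (fun x y => crossing (x, t) (y, t)) s x.
Proof.
have [x Px|s sP] := plane_like_primitive
  (c := fun x y => crossing (x, t) (y, t)) (planes t).
  have := leaf_clopen F_cont F_chart lam_cont lamK a x; apply: filterS => y Lyx Py.
  have := crossing_cocycle t Lyx Py.
  move=> /(near_continuous (@incidence_cont t y)).
  by apply: filterS => z + Pz; exact.
exists (fun x => s x (+) s a); split; first by rewrite addbb.
move=> x Px; apply: filterS (sP x Px) => y + Py => /(_ Py) ->.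
by rewrite addbAC.
Qed.

Lemma pencil_injective : a = b.
Proof.
have [s sP] := choice fibre_primitive.
apply: contrapT => ab.
have nLb : ~ L b by move=> /(leaf_base lamK) /(_ Fb).
have La : L a by exact: leaf_refl.
have [sa0 s_prim] : (forall t, s t a = false) /\ (forall t x,
    (F @^-1` pencil_plane t) x -> primitive_at (F @^-1` pencil_plane t)
      (fun x y => crossing (x, t) (y, t)) (s t) x).
  by split => t; case: (sP t).
(* The normalisation at [a] makes [t |-> (a, t)] a section along which the primitives match, so they
   form one primitive on the whole incidence set. *)
have good : forall z, incidence z ->
    primitive_at incidence crossing (fun z => s z.2 z.1) z.
  move=> z Iz; apply: (@fibrewise_primitive _ _ incidence snd (fun t => (a, t))
    crossing (fun z => s z.2 z.1)) => //=.
  - by move=> w; exact: cvg_snd.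
  - exact: incidence_chart.
  - exact: incidence_open.
  - move=> t.
    have -> : incidence `&` snd @^-1` [set t] =
        (fun x => (x, t)) @` (F @^-1` pencil_plane t).
      apply/seteqP; split => [[x t'] [/= Px t't]|_ [x Px <-]] //.
      by rewrite t't in Px *; exists x.
    apply: connected_continuous_connected; first exact: plane_like_connected.
    exact/continuous_subspaceT/incidence_cont.
  - move=> [x t] /= Px.
    have fst_cont : {for (x, t), continuous (fst : E * R -> E)} by exact: cvg_fst.
    apply: filterS (near_continuous fst_cont (s_prim t x Px)).
    by move=> [y t'] /= sE [Py /= t't]; rewrite t't in Py *; exact: sE.
  - by move=> t; apply: continuous_pair_at; [exact: cvg_cst | exact: cvg_id].
  - by move=> t; split => //; rewrite Fa; exact: pencil_plane_center.
  - move=> t; near=> t'.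
    by rewrite !sa0 /crossing /= Fa -[q]addr0 -(scale0r e) h_line ltxx andbF.
(* As [b] is not on [L], no jump occurs from [(b, t)] to [(b, t')]. *)
have sb : s (-1) b = s 1 b.
  apply: (@connected_locally_constant R _ setT (fun t => s t b)) => //.
    by apply/connected_intervalP.
  move=> t _.
  have Ib : incidence (b, t) by rewrite /= Fb; exact: pencil_plane_center.
  have b_cont : {for t, continuous (fun t : R => (b, t))}.
    by apply: continuous_pair_at; [exact: cvg_cst | exact: cvg_id].
  apply: filterS (near_continuous b_cont (good _ Ib)) => t' /= + _.
  rewrite Fb => /(_ (pencil_plane_center t')) ->.
  by rewrite /crossing /=; case: asboolP => //; rewrite addbF.
(* Both [s 1] and [s (-1)], the latter changed off [L], are primitives of the
   same cocycle, because [h] changes sign. *)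
pose s' x := s (-1) x (+) ~~ `[< L x >].
have planeE : pencil_plane (-1) = pencil_plane 1.
  apply/seteqP; split => y [al [be ->]]; exists al, (- be).
    by rewrite nu_flip scalerN scaleNr opprK.
  by rewrite nu_flip scalerN scaleNr.
have s'_prim x : (F @^-1` pencil_plane 1) x ->
    primitive_at (F @^-1` pencil_plane 1)
      (fun x y => crossing (x, 1) (y, 1)) s' x.
  move=> Px.
  have Px' : (F @^-1` pencil_plane (-1)) x by rewrite planeE.
  have := leaf_clopen F_cont F_chart lam_cont lamK a x.
  apply: filterS2 (s_prim (-1) x Px') => y + Lyx Py.
  rewrite planeE => /(_ Py) sy.
  rewrite /s' sy /crossing /= h_flip oppr_lt0.
  have [Lx|Lx] := asboolP (L x); last first.
    have /asboolPn/negbTE -> : ~ L y.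
      by move=> Ly; apply: Lx; apply/Lyx => //; exact: leaf_line Ly.
    by rewrite !addbF.
  have [Ly|Ly] := asboolP (L y).
    have [u Fy] := leaf_line Ly.
    by rewrite Fy h_line ltxx !addbF.
  (* Exactly one of the two crossings from [x] to [y] now counts, which matches the change of the
     correction term in [s']. *)
  have : h (-1) (F y) != 0.
    apply/eqP => /(h_eq0 (t := -1)); rewrite planeE => /(_ Py) Fy.
    by apply: Ly; exact/Lyx.
  by case: ltgtP => //= _ _; rewrite ?addbF ?addbT ?negbK.
(* The sum of [s 1] and [s'] is [false] at [a] but [true] at [b], a contradiction. *)
have := primitive_unique (plane_like_connected (planes 1)) (s_prim 1) s'_prim.
move=> /(_ a b); rewrite /= Fa Fb.
move=> /(_ (pencil_plane_center 1) (pencil_plane_center 1)).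
rewrite /s' !sa0 sb (asboolT La) (asboolF nLb) /=.
by case: (s 1 b).
Unshelve. all: by end_near. Qed.

End pencil.

(** * Smooth surfaces and affine planes in coordinates *)

Lemma smooth_on_near (R : realType) (V W : normedModType R) (S : set V)
    (f : V -> W) (x : V) (N : set W) : smooth_on S f -> S x -> nbhs (f x) N ->
  \forall y \near x, S y -> N (f y).
Proof.
move=> sf Sx fN; have [U [g [oU Ux sg gf]]] := sf x Sx.
have gc : {for x, continuous g} by exact: (sg 0%N).
rewrite -gf // in fN.
have Ug : nbhs x (U `&` [set y | N (g y)]).
  by apply: filterI; [exact: open_nbhs_nbhs | exact: near_continuous gc fN].
by apply: filterS Ug => y [Uy Ngy] Sy; rewrite -gf.
Qed.

Lemma diffeomorphism_plane_like (R : realType) n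
    (E := 'rV[R]_n : normedModType R) (S : set E) (f : E -> 'rV[R]_2) :
  diffeomorphism S [set: 'rV[R]_2] f -> plane_like S.
Proof.
move=> [sf [g [sg _ gS gf fg]]].
pose P := 'rV[R]_2 : normedModType R.
pose row (z : R * R) : P := z.1 *: delta_mx 0 0 + z.2 *: delta_mx 0 1.
have row_cont : continuous row.
  by move=> z; apply: cvgD; apply: cvgZl; [exact: cvg_fst | exact: cvg_snd].
have pair_cont : continuous (fun u : P => (u 0 0, u 0 1) : R * R).
  by move=> u; apply: continuous_pair_at; exact: coord_continuous.
have rowK (u : P) : row (u 0 0, u 0 1) = u.
  rewrite [RHS]row_sum_delta big_ord_recl big_ord1.
  by congr (_ + u 0 _ *: delta_mx 0 _); exact: val_inj.
exists (fun x => (f x 0 0, f x 0 1)), (g \o row); split.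
- move=> z; apply: continuous_comp; first exact: row_cont.
  move=> N gN; have := smooth_on_near sg I gN.
  by apply: filterS => w; exact.
- by move=> z; exact: gS.
- by move=> x Sx; rewrite /= rowK gf.
- move=> x N Sx fN; exact: smooth_on_near (near_continuous (pair_cont (f x)) fN).
Qed.

Lemma affine_plane_span (R : realType) n (q u v : 'rV[R]_n) :
  (forall s t : R, s *: u + t *: v = 0 -> s = 0 /\ t = 0) ->
  affine_plane [set y | exists s t : R, y = q + s *: u + t *: v].
Proof.
move=> free_uv.
pose W : 'M[R]_(2, n) := \matrix_(i, j) if i == 0 then u 0 j else v 0 j.
have mulW (c : 'rV[R]_2) : c *m W = c 0 0 *: u + c 0 1 *: v.
  rewrite mulmx_sum_row big_ord_recl big_ord1.
  congr (_ *: _ + c 0 _ *: _); first by apply/rowP => j; rewrite !mxE.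
    exact: val_inj.
  by apply/rowP => j; rewrite !mxE.
exists q, W; split.
  rewrite -kermx_eq0; apply/rowV0P => c /sub_kermxP; rewrite mulW => /free_uv[c0 c1].
  apply/rowP => i; rewrite mxE; case: (unliftP 0 i) => [j ->|-> //].
  by rewrite (ord1 j) -[RHS]c1; congr (c 0 _); exact: val_inj.
apply/seteqP; split => [y [s [t ->]]|_ [c _ <-]].
  exists (\row_i if i == 0 then s else t) => //.
  by rewrite mulW !mxE /= addrA.
by exists (c 0 0), (c 0 1); rewrite mulW addrA.
Qed.

Theorem corollary4p3 (R : realType) (n : nat) (n_ge3 : (3 <= n)%N)
    (F : 'rV[R]_n -> 'rV[R]_n) (F_local_diffeo : local_diffeomorphism F)
    (F_planes : forall P : set 'rV[R]_n, affine_plane P ->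
       exists phi : 'rV[R]_n -> 'rV[R]_2,
         conformal_diffeomorphism (F @^-1` P) [set: 'rV[R]_2] phi) :
  injective F.
Proof.
move=> a b Fab.
pose E : normedModType R := 'rV[R]_n.
(* One coordinate direction spans the line; the other two leave room for [nu] to turn around it. *)
pose i0 : 'I_n := Ordinal (leq_trans (isT : 0 < 3)%N n_ge3).
pose i1 : 'I_n := Ordinal (leq_trans (isT : 1 < 3)%N n_ge3).
pose i2 : 'I_n := Ordinal (leq_trans (isT : 2 < 3)%N n_ge3).
pose q : E := F a.
pose e : E := delta_mx 0 i0.
(* A rational curve in place of a rotation: it never vanishes, and
   [nu 1 = - nu (-1)]. *)
pose nu (t : R) : E := t *: delta_mx 0 i1 + (1 - t ^+ 2) *: delta_mx 0 i2.
pose lam (y : E) : R := y 0 i0 - q 0 i0.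
(* This is the inner product of [y - q] with [nu t], and [kappa t] is the squared Euclidean length
   of [nu t]. *)
pose h (t : R) (y : E) : R :=
  t * (y 0 i1 - q 0 i1) + (1 - t ^+ 2) * (y 0 i2 - q 0 i2).
pose kappa (t : R) : R := t ^+ 2 + (1 - t ^+ 2) ^+ 2.
have kappa_gt0 t : 0 < kappa t by rewrite /kappa; nra.
have coord (i : 'I_n) : continuous (fun y : E => y 0 i : R).
  exact: coord_continuous.
have neq : ((i0 == i1) = false) * ((i0 == i2) = false) * ((i1 == i0) = false) *
    ((i1 == i2) = false) * ((i2 == i0) = false) * ((i2 == i1) = false) by [].
apply: (@pencil_injective R E F q e nu lam h kappa) => //.
- move=> x; apply: differentiable_continuous.
  by have [+ _] := F_local_diffeo => /(_ 1%N) [+ _]; exact.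
- by move=> x N; exact: local_inverse.
- by move=> y; apply: (cvgB (coord i0 y)); exact: cvg_cst.
- by move=> u; rewrite /lam /e !mxE !eqxx mulr1 addrAC subrr add0r.
- move=> t; apply: cvgD; apply: cvgZl; first exact: cvg_id.
  by apply: cvgB; [exact: cvg_cst | exact: exprn_continuous].
- move=> z; have tc : {for z, continuous (snd : E * R -> R)} by exact: cvg_snd.
  have cc (i : 'I_n) : {for z, continuous (fun z : E * R => z.1 0 i - q 0 i : R)}.
    have fst_coord : {for z, continuous (fun w : E * R => w.1 0 i : R)}.
      apply: (@continuous_comp _ _ _ fst (fun y : E => y 0 i : R)).
        exact: cvg_fst.
      exact: coord.
    by apply: (cvgB fst_coord); exact: cvg_cst.
  apply: cvgD; apply: cvgM; [exact: tc | exact: cc | | exact: cc].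
  apply: cvgB; first exact: cvg_cst.
  apply: (@continuous_comp _ _ _ snd (fun t : R => t ^+ 2)); first exact: tc.
  exact: exprn_continuous.
- move=> t al be; rewrite /h /kappa /e /nu !mxE !neq !eqxx /=.
  ring.
- by move=> y; rewrite /h; ring.
- rewrite /nu sqrrN expr1n subrr !scale0r !addr0 scaleN1r opprK.
  exact: scale1r.
- move=> t; have [|phi [diffeo _]] := F_planes (pencil_plane q e nu t).
    apply: affine_plane_span => s r /rowP srE.
    have := srE i0; have := srE i1; have := srE i2.
    rewrite /e /nu !mxE !neq !eqxx /=.
    rewrite !(mulr0, mulr1, addr0, add0r) => rt2 rt1 ->.
    split => //.
    (* Both coefficients of [r *: nu t] vanish, and this combination of them recovers [r]. *)
    have -> : r = r * t * t + r * (1 - t ^+ 2) by ring.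
    by rewrite rt1 rt2 mul0r addr0.
  exact: diffeomorphism_plane_like diffeo.
Qed.
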